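(* Fix $s\in X$ and suppose there is a constant $\Lambda\ge1$ such that $$\left(\sum_{w\in W_k}a_s(w)\right)\left(\sum_{w\in W_k}\frac1{a_s(w)}\right)\le\Lambda m^{2k}$$ for every $k\ge0$ with $\sum_{w\in W_k}a_s(w)>0$ (where $1/0=+\infty$). Set $$S(s):=\sum_{k=0}^\infty\frac{m^k}{u_{2k+1}(s)-u_{2k}(s)}\in(0,\infty],$$ where a term with zero denominator is $+\infty$. Then the limit $R_\infty(s):=\lim_{N\to\infty}R_N(s)\in(0,\infty]$ exists and satisfies $$S(s)\le R_\infty(s)\le\Lambda S(s).$$ Equivalently, with $\mathrm{Cap}_\infty(s):=1/R_\infty(s)$ and $1/\infty=0$, $$\frac1{\Lambda S(s)}\le\mathrm{Cap}_\infty(s)\le\frac1{S(s)}.$$ In particular, $\mathrm{Cap}_\infty(s)>0$ if and only if $S(s)<\infty$.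
   Context: Let $X$ be a set, $m\ge1$ an integer, and $\varphi_1,\dots,\varphi_m:X\to X$ maps. A kernel $J:X\times X\to\mathbb{C}$ is positive definite if $\sum_{\alpha,\beta}\overline{c_\alpha}c_\beta J(s_\alpha,s_\beta)\ge0$ for all finite families $(c_\alpha,s_\alpha)\in\mathbb{C}\times X$; $J_1\le J_2$ means that $J_2-J_1$ is positive definite. The pullback operator is $(LJ)(s,t):=\sum_{i=1}^m J(\varphi_i(s),\varphi_i(t))$. Fix a positive definite kernel $K$ on $X$ with $LK\ge K$. Set $K_0:=K$, $K_{n+1}:=LK_n$ for $n\ge0$, and $u_n(s):=K_n(s,s)$; one has $K_{n+1}\ge K_n$ and $u_{n+1}(s)\ge u_n(s)$. Words: $W_n:=\{1,\dots,m\}^n$, $W_0=\{\emptyset\}$, $W_*:=\bigcup_{n\ge0}W_n$; for $w=i_1\cdots i_n\in W_n$, $|w|=n$ and $\varphi_w:=\varphi_{i_n}\circ\cdots\circ\varphi_{i_1}$ (with $\varphi_\emptyset=\mathrm{id}$). Network at $s\in X$: consider the rooted $m$-ary tree with vertex set $W_*$, root $\emptyset$, and edges $(w,wi)$, $w\in W_*$, $i\in\{1,\dots,m\}$. Put $a_s(w):=u_{|w|+1}(\varphi_w(s))-u_{|w|}(\varphi_w(s))\ge0$ and give the edge $e=(w,wi)$ the conductance $c_s(e):=a_s(w)/m^{|w|+1}$. A unit flow to depth $N\ge1$ is a nonnegative function $\theta$ on the edges $(w,wi)$ with $|w|\le N-1$ such that $\sum_{i=1}^m\theta(\emptyset,i)=1$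 and, for every vertex $w$ with $0<|w|<N$, $\theta(w^-,w)=\sum_{i=1}^m\theta(w,wi)$, where $w^-$ is the parent of $w$. Its energy is $\mathcal{E}_s(\theta):=\sum_e\theta(e)^2/c_s(e)\in[0,\infty]$, summed over all edges up to depth $N$; when $c_s(e)=0$ the term is $+\infty$ if $\theta(e)>0$ and $0$ if $\theta(e)=0$. Define $R_N(s):=\inf\{\mathcal{E}_s(\theta):\theta\text{ a unit flow to depth }N\}$. *)

(* Defs.v *)
From mathcomp Require Import all_boot all_order all_algebra.
From mathcomp Require Import complex.
From mathcomp Require Import all_classical all_reals all_analysis.
Set Implicit Arguments.
Unset Strict Implicit.
Unset Printing Implicit Defensive.
Import Order.TTheory GRing.Theory Num.Theory.
Import numFieldNormedType.Exports.
Local Open Scope classical_set_scope.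
Local Open Scope ring_scope.

Section Kernels.
Context {R : realType} {X : Type}.

Definition cplx_kernel := X -> X -> R[i].

(* On [R[i]], [0 <= z] means that [z] is real and nonnegative. *)
Definition posdef (J : cplx_kernel) : Prop :=
  forall (n : nat) (c : 'I_n -> R[i]) (s : 'I_n -> X),
    0 <= \sum_(a < n) \sum_(b < n) Num.conj (c a) * c b * J (s a) (s b).

Definition kernel_le (J1 J2 : cplx_kernel) : Prop :=
  posdef (fun s t => J2 s t - J1 s t).

Context {m : nat} (phi : 'I_m -> X -> X).

Definition pullback (J : cplx_kernel) : cplx_kernel :=
  fun s t => \sum_(i < m) J (phi i s) (phi i t).

Definition Kn (K : cplx_kernel) (n : nat) : cplx_kernel := iter n pullback K.

(* The diagonal of a positive definite kernel is real, so that taking the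
   real part only changes the type. *)
Definition un (K : cplx_kernel) (n : nat) (s : X) : R := complex.Re (Kn K n s s).

(* The letters of a word act from left to right: for [w = i_1 ... i_n],
   [phi_word w] is [phi i_n \o ... \o phi i_1]. *)
Definition phi_word (w : seq 'I_m) (s : X) : X :=
  foldl (fun x i => phi i x) s w.

Definition gap (K : cplx_kernel) (s : X) (w : seq 'I_m) : R :=
  un K (size w).+1 (phi_word w s) - un K (size w) (phi_word w s).

(* The edge [(w, wi)] of the [m]-ary tree is encoded by the pair [w], [i]. *)
Definition conductance (K : cplx_kernel) (s : X) (w : seq 'I_m) (i : 'I_m) : R :=
  gap K s w / (m ^ (size w).+1)%:R.

(* A flow is a function on all edges; its values on the edges [(w, wi)] with
   [N <= size w] are unconstrained, and do not enter [energy] at depth [N]. *)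
Definition unit_flow (N : nat) (theta : seq 'I_m -> 'I_m -> R) : Prop :=
  [/\ forall w i, (size w < N)%N -> 0 <= theta w i,
      \sum_(i < m) theta [::] i = 1
    & forall v j, (size (rcons v j) < N)%N ->
        theta v j = \sum_(i < m) theta (rcons v j) i].

(* In [\bar R], [0^-1 = +oo] and [0 * +oo = 0]; hence an edge of conductance
   zero contributes [+oo] if it carries flow and [0] otherwise. *)
Definition energy (K : cplx_kernel) (s : X) (N : nat)
    (theta : seq 'I_m -> 'I_m -> R) : \bar R :=
  (\sum_(k < N) \sum_(w : k.-tuple 'I_m) \sum_(i < m)
     (theta w i ^+ 2)%:E / (conductance K s w i)%:E)%E.

Definition resistance (K : cplx_kernel) (s : X) (N : nat) : \bar R :=
  ereal_inf [set energy K s N theta | theta in unit_flow N].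

Definition resistance_oo (K : cplx_kernel) (s : X) : \bar R :=
  limn (resistance K s).

Definition capacity_oo (K : cplx_kernel) (s : X) : \bar R :=
  ((resistance_oo K s)^-1)%E.

Definition level_series (K : cplx_kernel) (s : X) : \bar R :=
  (\sum_(0 <= k <oo)
     (m ^ k)%:R%:E / (un K (2 * k).+1 s - un K (2 * k) s)%:E)%E.

End Kernels.
Arguments cplx_kernel : clear implicits.

(* Main.v *)
Require Import Defs.
From mathcomp Require Import all_boot all_order all_algebra.
From mathcomp Require Import complex.
From mathcomp Require Import all_classical all_reals all_analysis.
From mathcomp Require Import ring.
Import Order.TTheory GRing.Theory Num.Theory.
Import numFieldNormedType.Exports.
Local Open Scope classical_set_scope.
Local Open Scope ring_scope.

(** The argument compares, level by level, the energy of a flow with one term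
    of the series. Write A_k for the sum of the gaps over the words of length
    k. Pulling the kernel back k times spreads the value at s over the points
    reached by the words of length k, so A_k equals
    u_(2k+1)(s) - u_(2k)(s) ([sum_gap]); hence the edges leaving level k have
    total conductance A_k / m^k. Positive definiteness of LK - K, pulled back
    in the same way, makes all gaps nonnegative ([gap_ge0]).

    Lower bound: conservation forces every unit flow to send total mass 1
    through the edges leaving each level ([unit_flow_total]), and the
    Cauchy-Schwarz inequality in the form (sum x)^2 / sum c <= sum x^2/c
    ([sqr_sum_div_le]) bounds the energy spent there below by m^k / A_k. This
    is the effect of short-circuiting each level.

    Upper bound: the flow that splits evenly at every vertex spends
    m^(-k) sum_w 1/a(w) at level k, which the regularity assumption bounds by
    Lambda m^k / A_k ([level_energy_uniform_ub]).

    Truncating a flow only removes energy, so the resistances increase with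
    the depth; their limit exists, and both bounds pass to it. The
    statements on the capacity follow by inverting. Degenerate edges are
    handled throughout in the extended reals, where 1/0 = +oo and
    0 * (+oo) = 0. *)

(** * Words and sums over the levels of the tree *)

Lemma sum_tuple0 (V : nmodType) (T : finType) (F : seq T -> V) :
  \sum_(w : 0.-tuple T) F w = F [::].
Proof.
rewrite (eq_bigr (fun=> F [::])) ?sumr_const ?card_tuple // => w _.
by rewrite tuple0.
Qed.

Lemma sum_tuple_cons (V : nmodType) (T : finType) (k : nat) (F : seq T -> V) :
  \sum_(w : k.+1.-tuple T) F w = \sum_(i : T) \sum_(w : k.-tuple T) F (i :: w).
Proof.
rewrite pair_big /=.
rewrite (reindex (fun p : T * k.-tuple T => [tuple of p.1 :: p.2])) //.
exists (fun w : k.+1.-tuple T => (thead w, [tuple of behead w])) => /=.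
  by move=> [i w] _ /=; congr pair; apply/val_inj.
by move=> w _; rewrite -tuple_eta.
Qed.

(** Pullbacks peel words at their first letter, whereas the conservation law of
    a flow concerns the last one. *)
Lemma sum_tuple_rcons (V : nmodType) (T : finType) (k : nat) (F : seq T -> V) :
  \sum_(w : k.+1.-tuple T) F w =
  \sum_(w : k.-tuple T) \sum_(i : T) F (rcons w i).
Proof.
elim: k F => [|k IH] F.
  rewrite sum_tuple_cons (sum_tuple0 _ _ (fun w => \sum_i F (rcons w i))).
  by apply: eq_bigr => i _; rewrite (sum_tuple0 _ _ (fun w => F (i :: w))).
rewrite sum_tuple_cons (sum_tuple_cons _ _ _ (fun w => \sum_i F (rcons w i))).
by apply: eq_bigr => i _; rewrite (IH (fun w => F (i :: w))).
Qed.

(** * Growth of the diagonals *)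

Section Diagonals.
Context {R : realType} {X : Type} {m : nat}.
Context (phi : 'I_m -> X -> X) (K : cplx_kernel R X).

(** Each of k pullbacks branches over one letter, the outermost over the first
    letter of the word; hence the induction keeps the starting point general. *)
Lemma un_add (n k : nat) (s : X) :
  un phi K (n + k) s = \sum_(w : k.-tuple 'I_m) un phi K n (phi_word phi w s).
Proof.
elim: k s => [|k IH] s.
  by rewrite addn0 (sum_tuple0 _ _ (fun w => un phi K n (phi_word phi w s))).
rewrite (sum_tuple_cons _ _ _ (fun w => un phi K n (phi_word phi w s))).
under [RHS]eq_bigr => i _ do rewrite -(IH (phi i s)).
rewrite addnS /un /= {1}/pullback.
by apply: (big_morph (@complex.Re R)) => // [] [a b] [c d].
Qed.

(** A word of length k contributes u_(k+1) - u_k at the point it reaches, and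
    summing over these points raises both indices by k. *)
Lemma sum_gap (k : nat) (s : X) :
  \sum_(w : k.-tuple 'I_m) gap phi K s w =
  un phi K (2 * k).+1 s - un phi K (2 * k) s.
Proof.
rewrite mul2n -addnn -addSn !un_add -sumrB.
by apply: eq_bigr => w _; rewrite /gap size_tuple.
Qed.

(** The increment at index n is the sum, over the points reached by the words of
    length n, of the increment at index 0, and the latter is a diagonal value
    of the positive definite kernel LK - K. *)
Lemma un_incr (hLK : kernel_le K (pullback phi K)) (n : nat) (s : X) :
  un phi K n s <= un phi K n.+1 s.
Proof.
(* Positive definiteness is tested on one point with coefficient 1. *)
have un01 x : un phi K 0 x <= un phi K 1 x.
  have := hLK 1 (fun=> 1) (fun=> x).
  rewrite !big_ord1 conjC1 !mul1r lecE => /andP[_].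
  rewrite /un /=; case: (pullback _ _ _ _) => a b; case: (K x x) => c d /=.
  by rewrite subr_ge0.
by rewrite -[n]add0n -addSn !un_add; apply: ler_sum.
Qed.

Lemma gap_ge0 (hLK : kernel_le K (pullback phi K)) (s : X) (w : seq 'I_m) :
  0 <= gap phi K s w.
Proof. by rewrite subr_ge0 un_incr. Qed.

End Diagonals.

(** * Extended real quotients *)

Lemma inveM_pos (R : realType) (x y : R) : 0 < x ->
  ((x * y)%:E^-1 = x^-1%:E * y%:E^-1)%E.
Proof.
move=> x0; have [->|y0] := eqVneq y 0.
  by rewrite mulr0 inve0 gt0_muley // lte_fin invr_gt0.
by rewrite !inver mulf_eq0 (negPf y0) gt_eqF //= invfM EFinM.
Qed.

Lemma edivr_ge0 (R : realType) (x y : R) : 0 <= x -> 0 <= y ->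
  (0 <= x%:E / y%:E)%E.
Proof. by move=> x0 y0; rewrite mule_ge0 ?inve_ge0 ?lee_fin. Qed.

(** The left side is the tangent line of x^2/c at the point x = t c. Unlike the
    quotient it is finite and linear in (x, c), so that it can be summed even
    when some c vanish. *)
Lemma sqr_div_ge_tangent (R : realType) (t x c : R) : 0 <= c ->
  ((2 * t * x - t ^+ 2 * c)%:E <= (x ^+ 2)%:E / c%:E)%E.
Proof.
rewrite le_eqVlt => /predU1P[<-|c0].
  have [->|x0] := eqVneq x 0; first by rewrite !mulr0 subr0 expr0n mul0e.
  by rewrite inve0 gt0_muley ?leey // lte_fin exprn_even_gt0.
rewrite inver gt_eqF //= -EFinM lee_fin ler_pdivlMr // -subr_ge0.
rewrite (_ : _ - _ = (x - t * c) ^+ 2) ?sqr_ge0 //.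
by rewrite !expr2; ring.
Qed.

(** The Cauchy-Schwarz inequality for quotients, valid with the conventions
    x^2/0 = +oo and 0/0 = 0: sum the tangent lines and choose the slope t
    afterwards. If the total of c is positive, the best slope is the ratio of
    the totals; if it is zero, every slope is admissible and the sum exceeds
    every real number. *)
Lemma sqr_sum_div_le (R : realType) (I : finType) (x c : I -> R) :
  (forall i, 0 <= c i) ->
  (((\sum_i x i) ^+ 2)%:E / (\sum_i c i)%:E <=
     \sum_i (x i ^+ 2)%:E / (c i)%:E)%E.
Proof.
move=> c0; set X := \sum_i x i; set C := \sum_i c i; set S := (leRHS).
have C0 : 0 <= C by apply: sumr_ge0.
have tangent t : ((2 * t * X - t ^+ 2 * C)%:E <= S)%E.
  rewrite !mulr_sumr -sumrB -sumEFin.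
  by apply: lee_sum => i _; apply: sqr_div_ge_tangent.
have S0 : (0 <= S)%E by have := tangent 0; rewrite expr0n !mulr0 !mul0r subr0.
have [CE|Cn0] := eqVneq C 0; last first.
  have := tangent (X / C); congr (_ <= _)%E.
  by rewrite inver (negPf Cn0) -EFinM; congr (_%:E); field.
have [->|Xn0] := eqVneq X 0; first by rewrite expr0n mul0e.
rewrite CE inve0 gt0_muley ?lte_fin ?exprn_even_gt0 // leye_eq.
(* If the sum had a finite value r, this slope would give r + 1 <= r. *)
case: S S0 tangent => [r||] // _ /(_ ((r + 1) / (2 * X))).
rewrite CE lee_fin mulr0 subr0.
have -> : 2 * ((r + 1) / (2 * X)) * X = r + 1 by field.
by rewrite gerDl ler10.
Qed.

(** * Level energies *)

Section Energy.
Context {R : realType} {X : Type} {m : nat}.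
Context (phi : 'I_m -> X -> X) (K : cplx_kernel R X).

Definition level_energy (s : X) (theta : seq 'I_m -> 'I_m -> R) (k : nat) :
    \bar R :=
  (\sum_(w : k.-tuple 'I_m) \sum_(i < m)
     (theta w i ^+ 2)%:E / (conductance phi K s w i)%:E)%E.

Definition level_term (s : X) (k : nat) : \bar R :=
  ((m ^ k)%:R%:E / (un phi K (2 * k).+1 s - un phi K (2 * k) s)%:E)%E.

(** Conservation hands the mass leaving level k - 1 over to level k, and the
    root emits mass 1. *)
Lemma unit_flow_total {N : nat} {theta : seq 'I_m -> 'I_m -> R} (k : nat) :
  unit_flow N theta -> (k < N)%N ->
  \sum_(w : k.-tuple 'I_m) \sum_(i < m) theta w i = 1.
Proof.
move=> [_ root conserved]; elim: k => [|k IH] kN.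
  by rewrite (sum_tuple0 _ _ (fun w => \sum_(i < m) theta w i)).
rewrite (sum_tuple_rcons _ _ _ (fun w => \sum_(i < m) theta w i)).
rewrite -IH ?(ltnW kN) //.
apply: eq_bigr => w _; apply: eq_bigr => j _.
by rewrite -conserved // size_rcons size_tuple.
Qed.

(** Cauchy-Schwarz over all edges leaving level k: they carry total mass 1 and
    have total conductance A_k / m^k. *)
Lemma level_energy_lb (hm : (1 <= m)%N) (hLK : kernel_le K (pullback phi K))
    (s : X) (N k : nat) (theta : seq 'I_m -> 'I_m -> R) :
  unit_flow N theta -> (k < N)%N ->
  (level_term s k <= level_energy s theta k)%E.
Proof.
move=> flow kN.
have mX0 n : 0 < (m ^ n)%:R :> R by rewrite ltr0n expn_gt0 hm.
have := @sqr_sum_div_le R _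
  (fun p : k.-tuple 'I_m * 'I_m => theta p.1 p.2)
  (fun p => conductance phi K s p.1 p.2).
rewrite -(pair_bigA _ (fun (w : k.-tuple 'I_m) i => theta w i)) /=.
rewrite -(pair_bigA _ (fun (w : k.-tuple 'I_m) i => conductance phi K s w i)) /=.
rewrite -(pair_bigA _ (fun (w : k.-tuple 'I_m) i =>
  (theta w i ^+ 2)%:E / (conductance phi K s w i)%:E)%E) /=.
rewrite (unit_flow_total k flow kN) expr1n mul1e.
have -> : \sum_(w : k.-tuple 'I_m) \sum_(i < m) conductance phi K s w i =
    (m ^ k)%:R^-1 * (un phi K (2 * k).+1 s - un phi K (2 * k) s).
  rewrite -sum_gap mulr_sumr; apply: eq_bigr => w _.
  rewrite /conductance sumr_const card_ord size_tuple expnS natrM.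
  have := mX0 1%N; have := mX0 k; rewrite expn1 => /lt0r_neq0 ? /lt0r_neq0 ?.
  by rewrite -mulr_natr; field; apply/andP.
rewrite inveM_pos ?invr_gt0 // invrK; apply => p.
by rewrite divr_ge0 ?gap_ge0 // ltW.
Qed.

Definition uniform_flow (w : seq 'I_m) (i : 'I_m) : R :=
  (m ^ (size w).+1)%:R^-1.

Lemma uniform_flowP (hm : (1 <= m)%N) (N : nat) : unit_flow N uniform_flow.
Proof.
have m0 : m%:R != 0 :> R by rewrite pnatr_eq0 -lt0n.
split=> [w i _||v j _].
- by rewrite invr_ge0.
- by rewrite /uniform_flow sumr_const card_ord expn1 -[LHS]mulr_natr mulVf.
- rewrite /uniform_flow sumr_const card_ord size_rcons (expnS _ (size v).+1).
  by rewrite natrM invfM -[RHS]mulr_natr mulrAC mulVf ?mul1r.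
Qed.

(** Each word w has m outgoing edges, each of energy
    m^(-2(k+1)) * m^(k+1) / a(w). *)
Lemma level_energy_uniform (hm : (1 <= m)%N)
    (hLK : kernel_le K (pullback phi K)) (s : X) (k : nat) :
  level_energy s uniform_flow k =
  ((m ^ k)%:R^-1%:E * \sum_(w : k.-tuple 'I_m) ((gap phi K s w)%:E)^-1)%E.
Proof.
have mX0 n : 0 < (m ^ n)%:R :> R by rewrite ltr0n expn_gt0 hm.
rewrite ge0_sume_distrr => [|w _]; last by rewrite inve_ge0 lee_fin gap_ge0.
apply: eq_bigr => w _.
have m0 : m%:R != 0 :> R by rewrite pnatr_eq0 -lt0n.
have -> : (m ^ k)%:R^-1 = \sum_(i < m) (m ^ k.+1)%:R^-1 :> R.
  rewrite sumr_const card_ord -[RHS]mulr_natr expnS natrM invfM.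
  by rewrite mulrAC mulVf ?mul1r.
rewrite -sumEFin ge0_sume_distrl => [|i _]; last by rewrite lee_fin invr_ge0.
apply: eq_bigr => i _; rewrite /uniform_flow /conductance size_tuple.
rewrite [gap _ _ _ _ / _]mulrC inveM_pos ?invr_gt0 // invrK muleA -EFinM.
by rewrite expr2 -mulrA mulVf ?mulr1 // gt_eqF.
Qed.

Lemma level_energy_ge0 (hLK : kernel_le K (pullback phi K))
    (s : X) (theta : seq 'I_m -> 'I_m -> R) (k : nat) :
  (0 <= level_energy s theta k)%E.
Proof.
apply: sume_ge0 => w _; apply: sume_ge0 => i _.
by rewrite edivr_ge0 ?sqr_ge0 // divr_ge0 ?gap_ge0.
Qed.

(** If the gaps of the level have positive sum, dividing the regularity bound
    by this sum gives the claim; otherwise the right side is +oo. *)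
Lemma level_energy_uniform_ub (hm : (1 <= m)%N)
    (hLK : kernel_le K (pullback phi K))
    (s : X) (Lambda : R) (Lambda0 : 0 < Lambda) (k : nat)
    (regular : 0 < \sum_(w : k.-tuple 'I_m) gap phi K s w ->
      ((\sum_(w : k.-tuple 'I_m) gap phi K s w)%:E
         * (\sum_(w : k.-tuple 'I_m) ((gap phi K s w)%:E)^-1)
       <= (Lambda * (m ^ (2 * k))%:R)%:E)%E) :
  (level_energy s uniform_flow k <= Lambda%:E * level_term s k)%E.
Proof.
have mk0 : 0 < (m ^ k)%:R :> R by rewrite ltr0n expn_gt0 hm.
move: regular; rewrite level_energy_uniform // /level_term -sum_gap.
set A := \sum_(w : k.-tuple 'I_m) _.
have A0 : 0 <= A by apply: sumr_ge0 => w _; apply: gap_ge0.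
have [A1 /(_ isT)|/le_gtF A1 _] := ltP 0 A; last first.
  have -> : A = 0 by apply/eqP; rewrite eq_le A0 andbT leNgt A1.
  by rewrite inve0 !gt0_muley ?leey ?lte_fin.
rewrite muleC -lee_pdivlMr // inver gt_eqF //= => le_inv.
apply: (@le_trans _ _ ((m ^ k)%:R^-1%:E *
    ((Lambda * (m ^ (2 * k))%:R)%:E * A^-1%:E))%E).
  by apply: lee_wpmul2l => //; rewrite lee_fin invr_ge0.
rewrite -!EFinM lee_fin mul2n -addnn expnD natrM le_eqVlt; apply/orP; left.
by apply/eqP; field; rewrite !gt_eqF.
Qed.

Lemma level_term_ge0 (hLK : kernel_le K (pullback phi K)) (s : X) (k : nat) :
  (0 <= level_term s k)%E.
Proof. by rewrite edivr_ge0 // subr_ge0 un_incr. Qed.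

(** The term of index 0 is already positive: it is the inverse of a finite
    nonnegative number, equal to +oo when this number is 0. *)
Lemma level_series_gt0 (hLK : kernel_le K (pullback phi K)) (s : X) :
  (0 < level_series phi K s)%E.
Proof.
apply: (@lt_le_trans _ _ (level_term s 0)).
  have : 0 <= un phi K 1 s - un phi K 0 s by rewrite subr_ge0 un_incr.
  rewrite /level_term expn0 mul1e muln0; set d := _ - _.
  by rewrite le_eqVlt => /predU1P[<-|d0]; rewrite ?inve0 // inve_gt0 // gt_eqF.
rewrite -[leLHS](big_nat1 +%E 0 (level_term s)).
by apply: nneseries_lim_ge => k _ _; apply: level_term_ge0.
Qed.

Lemma unit_flow_truncate (N : nat) (theta : seq 'I_m -> 'I_m -> R) :
  unit_flow N.+1 theta -> unit_flow N theta.
Proof.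
move=> [nneg root conserved]; split=> // [w i wN|v j vN].
  exact/nneg/ltnW.
exact/conserved/ltnW.
Qed.

(** A flow to depth N + 1 is also a flow to depth N, where its energy lacks the
    nonnegative contribution of the last level. *)
Lemma resistance_nondecreasing (hLK : kernel_le K (pullback phi K)) (s : X) :
  nondecreasing_seq (resistance phi K s).
Proof.
apply/nondecreasing_seqP => N; apply: le_ereal_inf_tmp => _ [theta flow <-].
apply: ge_ereal_inf; exists (energy phi K s N theta).
  by exists theta => //; apply: unit_flow_truncate.
rewrite /energy big_ord_recr /= leeDl //.
exact: (level_energy_ge0 hLK s theta N).
Qed.

Lemma resistance_lb (hm : (1 <= m)%N) (hLK : kernel_le K (pullback phi K))
    (s : X) (N : nat) :
  (\sum_(0 <= k < N) level_term s k <= resistance phi K s N)%E.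
Proof.
apply: le_ereal_inf_tmp => _ [theta flow <-].
rewrite big_mkord; apply: lee_sum => k _.
exact: (level_energy_lb hm hLK s N).
Qed.

End Energy.

(** * Comparison of the resistance with the series *)

Theorem corollary2p13 (R : realType) (X : Type) (m : nat) (hm : (1 <= m)%N)
    (phi : 'I_m -> X -> X) (K : cplx_kernel R X)
    (hK : posdef K) (hLK : kernel_le K (pullback phi K))
    (s : X) (Lambda : R) (hLambda : 1 <= Lambda)
    (hreg : forall k : nat,
      0 < \sum_(w : k.-tuple 'I_m) gap phi K s w ->
      ((\sum_(w : k.-tuple 'I_m) gap phi K s w)%:E
         * (\sum_(w : k.-tuple 'I_m) ((gap phi K s w)%:E)^-1)
       <= (Lambda * (m ^ (2 * k))%:R)%:E)%E) :
  [/\ (0 < level_series phi K s)%E,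
      cvgn (resistance phi K s) /\ (0 < resistance_oo phi K s)%E,
      (level_series phi K s <= resistance_oo phi K s
         <= Lambda%:E * level_series phi K s)%E,
      ((Lambda%:E * level_series phi K s)^-1 <= capacity_oo phi K s
         <= (level_series phi K s)^-1)%E
    & (0 < capacity_oo phi K s)%E <-> (level_series phi K s < +oo)%E].
Proof.
have L0 : 0 < Lambda by apply: lt_le_trans hLambda.
have S0 := level_series_gt0 _ _ hLK s.
have mono := resistance_nondecreasing _ _ hLK s.
have cvgR := ereal_nondecreasing_is_cvgn mono.
have term0 k : (0 <= level_term phi K s k)%E by apply: level_term_ge0.
have SR : (level_series phi K s <= resistance_oo phi K s)%E.
  apply: lee_lim => //; first by apply: is_cvg_nneseries => k _ _; exact: term0.
  by apply: nearW => N; apply: resistance_lb.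
have RS : (resistance_oo phi K s <= Lambda%:E * level_series phi K s)%E.
  rewrite -nneseriesZl => [|k _]; last exact: term0.
  apply: lime_le => //; apply: nearW => N.
  apply: le_trans (nneseries_lim_ge N _) => [|k _ _]; last first.
    by apply: mule_ge0; [rewrite lee_fin ltW|exact: term0].
  apply: ge_ereal_inf; exists (energy phi K s N uniform_flow).
    by exists uniform_flow => //; apply: uniform_flowP.
  rewrite big_mkord; apply: lee_sum => k _.
  exact: level_energy_uniform_ub (hreg k).
have R0 := lt_le_trans S0 SR.
have LS0 : (0 < Lambda%:E * level_series phi K s)%E by rewrite mule_gt0.
split => //; first by rewrite SR.
- by rewrite /capacity_oo !lee_pV2 ?inE ?(ltW S0) ?(ltW R0) ?(ltW LS0) // RS.
- rewrite /capacity_oo; split=> [cap0|Soo].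
    apply: le_lt_trans SR _; rewrite ltey; apply/eqP => Roo.
    by move: cap0; rewrite Roo invey ltxx.
  have Roo : (resistance_oo phi K s < +oo)%E.
    by apply: le_lt_trans RS _; rewrite lte_mul_pinfty // ltW.
  by rewrite inve_gt0 ?(gt_eqF R0) ?(lt_eqF Roo).
Qed.
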